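(* There exist absolute constants $\alpha,\beta>0$ such that the following holds. Let $X$ be a finite set and let $C\subseteq\{0,1\}^X$ be a concept class with $|C|\ge 2$ and VC-dimension $d$. Then there exist a positive integer $k$ and a finite nonempty set $Q$ with $$k\le \alpha\, d\,2^d\log\log|C|+\beta\qquad\text{and}\qquad \log|Q|\le \alpha\, k\log k+\beta$$ such that $C$ has a $k$-sample compression scheme with information $Q$.
   Context: A concept class over a set $X$ is a set $C\subseteq\{0,1\}^X$ of functions $X\to\{0,1\}$. A set $Y\subseteq X$ is shattered by $C$ if for every $Z\subseteq Y$ there is $c\in C$ with $c(x)=1$ for all $x\in Z$ and $c(x)=0$ for all $x\in Y\setminus Z$. The VC-dimension of $C$ is the maximum size of a subset of $X$ shattered by $C$. For $Y\subseteq X$, $C|_Y=\{c|_Y:c\in C\}\subseteq\{0,1\}^Y$. Let $n=|X|$. For integers $0\le k_1\le k_2$ let $$L_C(k_1,k_2)=\{(Y,y): Y\subseteq X,\ k_1\le|Y|\le k_2,\ y\in C|_Y\}$$ be the set of labelled samples from $C$ of sizes between $k_1$ and $k_2$. A $k$-sample compression scheme for $C$ with information $Q$ consists of two maps $\kappa,\rho$ such that: - the compression map $\kappa:L_C(1,n)\to L_C(0,k)\times Q$ takes each $(Y,y)$ to some $((Z,z),q)$ with $Z\subseteq Y$ and $y|_Z=z$; - the reconstruction map $\rho:L_C(0,k)\times Q\to\{0,1\}^X$ satisfies $\rho(\kappa(Y,y))|_Y=y$ for all $(Y,y)\in L_C(1,n)$. (The reconstructed function $\rho(\kappa(Y,y))$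 is not required to belong to $C$.) Logarithms are to base $2$. *)

(* Defs.v *)
From HB Require Import structures.
From mathcomp Require Import all_boot all_order all_algebra.
From mathcomp Require Import reals exp.

Set Implicit Arguments.
Unset Strict Implicit.
Unset Printing Implicit Defensive.

Import Order.TTheory GRing.Theory Num.Theory.

Definition log2 (R : realType) (x : R) : R := (ln x / ln 2)%R.

Definition concept_class (X : finType) : Type := {set {ffun X -> bool}}.

Definition shatters (X : finType) (C : concept_class X) (Y : {set X}) : bool :=
  [forall Z : {set X}, (Z \subset Y) ==>
    [exists c in C, [forall x in Z, c x == true] &&
                    [forall x in Y :\: Z, c x == false]]].

(* For the empty class, which shatters no set, this maximum is 0. *)
Definition vc_dim (X : finType) (C : concept_class X) : nat :=
  \max_(Y : {set X} | shatters C Y) #|Y|.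

Definition restr (X : finType) (Y : {set X}) (c : {ffun X -> bool}) :
    {ffun {x : X | x \in Y} -> bool} :=
  [ffun u => c (val u)].

Definition restr_class (X : finType) (C : concept_class X) (Y : {set X}) :
    {set {ffun {x : X | x \in Y} -> bool}} :=
  [set restr Y c | c in C].

(* Pairs (Y, y) with y : Y -> {0,1}, not necessarily coming from a class. *)
Definition sample (X : finType) : Type :=
  {Y : {set X} & {ffun {x : X | x \in Y} -> bool}}.

Definition labelled_sample (X : finType) (C : concept_class X) (k1 k2 : nat)
    (s : sample X) : bool :=
  (k1 <= #|tag s| <= k2) && (tagged s \in restr_class C (tag s)).

Definition L (X : finType) (C : concept_class X) (k1 k2 : nat) : Type :=
  {s : sample X | labelled_sample C k1 k2 s}.

(* t = (Z, z) and s = (Y, y) satisfy Z \subset Y and y|_Z = z. *)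
Definition subsample (X : finType) (t s : sample X) : Prop :=
  tag t \subset tag s /\
  forall (u : {x : X | x \in tag s}) (v : {x : X | x \in tag t}),
    val u = val v -> tagged s u = tagged t v.

Definition compression_scheme (X : finType) (C : concept_class X) (k : nat)
    (Q : Type) (kappa : L C 1 #|X| -> L C 0 k * Q)
    (rho : L C 0 k * Q -> {ffun X -> bool}) : Prop :=
  forall s : L C 1 #|X|,
    subsample (sval (kappa s).1) (sval s) /\
    restr (tag (sval s)) (rho (kappa s)) = tagged (sval s).

Definition has_compression_scheme (X : finType) (C : concept_class X) (k : nat)
    (Q : Type) : Prop :=
  exists (kappa : L C 1 #|X| -> L C 0 k * Q)
         (rho : L C 0 k * Q -> {ffun X -> bool}),
    compression_scheme kappa rho.

(* Main.v *)
Require Import Defs.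
From HB Require Import structures.
From mathcomp Require Import all_boot all_order all_algebra.
From mathcomp Require Import reals exp.
From mathcomp Require Import boolp zify ring lra.

Set Implicit Arguments.
Unset Strict Implicit.
Unset Printing Implicit Defensive.

Import Order.TTheory GRing.Theory Num.Theory.
Local Open Scope ring_scope.

(* Let d be the VC-dimension.  Double sampling shows that some d K points of any
   finite domain (K an absolute constant) estimate from below, up to 1/8, the
   frequency of every member of a family of VC-dimension d.  Applied to the
   error sets of C this makes every concept consistent on few well-chosen points
   of Y a weak learner, for any weights on Y; multiplicative weights then combine
   such concepts into a long list whose error at each point of Y is at most 1/4.
   The dual family has VC-dimension at most 2^(d+1), so sampling a second time
   replaces the list by K 2^(d+1) concepts whose majority is still correct on Y.
   The compressed sample is the union of the consistency sets, and Q records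
   which points each of them uses; k = 2 K^2 d 2^d does not depend on |C|, and
   log log |C| >= 1 as soon as d >= 2. *)

(** * The Sauer-Shelah bound *)

Section SauerShelah.
Local Open Scope nat_scope.
Variable J : finType.
Implicit Types (F : {set {set J}}) (A B S Z : {set J}).

Definition set_shatters F S : Prop :=
  forall Z, Z \subset S -> exists2 B, B \in F & B :&: S = Z.

Lemma set_shatters_sub F A S :
  {in F, forall B, B \subset A} -> set_shatters F S -> S \subset A.
Proof.
move=> FA /(_ S (subxx S))[B /FA BA BS]; rewrite -BS.
exact: subset_trans (subsetIl _ _) BA.
Qed.

(** This form avoids binomial sums: removing a point splits the count into families of dimensions
    [d] and [d - 1], and [L ^ d + L ^ (d - 1) = L ^ (d - 1) * (L + 1)]. *)
Lemma sauer (L d : nat) F A :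
  0 < L -> {in F, forall B, B \subset A} ->
  (forall S, set_shatters F S -> #|S| <= d) ->
  #|F| * L ^ #|A| <= L ^ d * L.+1 ^ #|A|.
Proof.
move=> L0; move En: #|A| => n; elim: n => [|n IHn] in A En d F * => FA Fd.
  have : F \subset [set set0].
    apply/subsetP=> B /FA; rewrite (cards0_eq En) subset0.
    by rewrite inE.
  move/subset_leq_card; rewrite cards1 !expn0 !muln1 => F1.
  by apply: leq_trans F1 _; rewrite expn_gt0 L0.
have [x xA] : exists x, x \in A by apply/card_gt0P; rewrite En.
(* Deleting [x] maps [F] onto [F0 :|: F1]; the sets hit twice form [F0 :&: F1]. *)
pose F0 := [set B in F | x \notin B].
pose F1 := [set B :\ x | B in F :\: F0].
have cF : #|F| = #|F0 :|: F1| + #|F0 :&: F1|.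
  rewrite cardsUI card_in_imset; last first.
    move=> B B'; rewrite !inE => /andP[+ BF] /andP[+ BF'] E.
    rewrite BF BF' /= !negbK => xB xB'.
    by rewrite -(setD1K xB) -(setD1K xB') E.
  rewrite -(cardsID F0 F); congr (_ + _); apply: eq_card => B.
  by rewrite !inE andbA andbb.
have cA : #|A :\ x| = n by move: En; rewrite (cardsD1 x A) xA; case.
have F1P B : B \in F1 -> (x |: B \in F) /\ (x \notin B).
  case/imsetP=> B'; rewrite !inE => /andP[+ BF].
  rewrite BF /= negbK => xB ->; rewrite setD1K //; split=> //.
  by rewrite !inE eqxx.
have UA : {in F0 :|: F1, forall B, B \subset A :\ x}.
  move=> B; rewrite inE subsetD1 => /orP[].
    by rewrite inE => /andP[/FA -> ->].
  by case/F1P=> /FA; rewrite subUset => /andP[_ ->] ->.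
have IA : {in F0 :&: F1, forall B, B \subset A :\ x}.
  by move=> B /setIP[B0 _]; apply: UA; rewrite inE B0.
have HU : #|F0 :|: F1| * L ^ n <= L ^ d * L.+1 ^ n.
  apply: (IHn _ cA) => // S sS; apply: Fd => Z ZS.
  have : x \notin S.
    by have := set_shatters_sub UA sS; rewrite subsetD1 => /andP[].
  move=> xS; have [B BU BS] := sS Z ZS.
  move: BU; rewrite inE => /orP[|/F1P[BF xB]].
    by rewrite inE => /andP[BF _]; exists B.
  exists (x |: B) => //; rewrite -BS; apply/setP=> z; rewrite !inE.
  by case: eqP => // ->; rewrite (negbTE xS) !andbF.
(* For [B] in the intersection both [B] and [x |: B] lie in [F], so [x] can be added to any set it
   shatters. *)
have HI S : set_shatters (F0 :&: F1) S -> #|S|.+1 <= d.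
  move=> sS; have xS : x \notin S.
    by have := set_shatters_sub IA sS; rewrite subsetD1 => /andP[].
  have -> : #|S|.+1 = #|x |: S| by rewrite cardsU1 xS.
  apply: Fd => Z ZS.
  have [|B] := sS (Z :\ x); first by rewrite subDset.
  rewrite inE => /andP[]; rewrite inE => /andP[BF xB] /F1P[xBF _] E.
  exists (if x \in Z then x |: B else B); first by case: ifP.
  apply/setP=> z; have := ZS => /subsetP/(_ z).
  move/setP/(_ z): E; case: ifP => xZ; rewrite !inE.
    by case: eqP => [->|_] //=; rewrite xZ.
  by case: eqP => [->|_] //=; rewrite xZ (negbTE xB).
rewrite cF mulnDl !expnS.
case: d => [|d] in Fd HU HI *.
  have -> : F0 :&: F1 = set0.
    apply/setP=> B; rewrite in_set0; apply/negP=> BI.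
    suff /HI : set_shatters (F0 :&: F1) set0 by [].
    by move=> Z; rewrite subset0 => /eqP ->; exists B; rewrite ?setI0.
  by rewrite cards0; nia.
have : #|F0 :&: F1| * L ^ n <= L ^ d * L.+1 ^ n.
  by apply: (IHn _ cA) => // S /HI.
by rewrite expnS in HU *; nia.
Qed.

End SauerShelah.

(** * Second moments of random samples *)

Section Chebyshev.
Variables (T : finType) (m : nat).

(** Distinct coordinates of [v] are independent and [X] is centred, so only the [m] diagonal terms
    of the expanded square survive. *)
Lemma second_moment (X : T -> int) :
  \sum_t X t = 0 ->
  \sum_(v : {ffun 'I_m -> T}) (\sum_j X (v j)) ^+ 2 =
  (m * #|T| ^ m.-1)%:R * \sum_t X t ^+ 2.
Proof.
move=> X0.
have E (j k : 'I_m) : \sum_(v : {ffun 'I_m -> T}) X (v j) * X (v k) =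
    if j == k then (#|T| ^ m.-1)%:R * \sum_t X t ^+ 2 else 0.
  pose g l t := (if l == j then X t else 1) * (if l == k then X t else 1).
  transitivity (\sum_(v : {ffun 'I_m -> T}) \prod_l g l (v l)).
    apply: eq_bigr => v _; rewrite big_split /= -!big_mkcond /=.
    by rewrite !big_pred1_eq.
  rewrite -(bigA_distr_bigA g) (bigD1 j) //= /g eqxx.
  case: eqP => [<-|/eqP jk].
    rewrite mulrC; congr (_ * _).
    rewrite (eq_bigr (fun=> #|T|%:R)) => [|l /negbTE -> ]; last first.
      by rewrite mul1r sumr_const.
    by rewrite prodr_const cardC1 card_ord natrX.
  by rewrite (eq_bigr X) ?X0 ?mul0r // => t _; rewrite mulr1.
transitivity (\sum_(j < m) \sum_(k < m)
    \sum_(v : {ffun 'I_m -> T}) X (v j) * X (v k)).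
  under [RHS]eq_bigr => j _ do rewrite exchange_big /=.
  rewrite exchange_big /=; apply: eq_bigr => v _; rewrite expr2 mulr_suml.
  by apply: eq_bigr => j _; rewrite mulr_sumr.
rewrite (eq_bigr (fun=> (#|T| ^ m.-1)%:R * \sum_t X t ^+ 2)); last first.
  move=> j _; rewrite (bigD1 j) //= E eqxx [X in _ + X]big1 ?addr0 // => k kj.
  by rewrite E eq_sym (negbTE kj).
by rewrite sumr_const card_ord natrM -mulrA -[LHS]mulr_natl.
Qed.

(** Up to the factor [16 * m * #|T|], the event says that the sample frequency of [p] is more than
    1/16 below the true one; Chebyshev bounds its probability by [256 / m]. *)
Lemma chebyshev_sample (p : pred T) :
  (512 <= m)%N ->
  (2 * #|[set v : {ffun 'I_m -> T} |
       16 * #|T| * #|[set j | p (v j)]| + m * #|T| < 16 * m * #|[set t | p t]|]|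
    <= #|T| ^ m)%N.
Proof.
move=> m512; set B := finset _; set M := #|T|; set a := #|[set t | p t]|.
have aM : (a <= M)%N by apply: max_card.
have [->|B0] := posnP #|B|; first by rewrite muln0.
pose X t : int := M%:Z * (p t)%:Z - a%:Z.
have sp (J : finType) (q : pred J) : \sum_j (q j)%:Z = (#|[set j | q j]|)%:Z.
  rewrite -sum1_card [in RHS]big_mkcond [RHS](big_morph Posz PoszD erefl).
  by apply: eq_bigr => j _; rewrite inE; case: (q j).
have X0 : \sum_t X t = 0.
  rewrite sumrB -mulr_sumr sp sumr_const -/M -/a -mulr_natr; lia.
have X2 : \sum_t X t ^+ 2 <= (M ^ 3)%:Z.
  apply: (@le_trans _ _ (\sum_(t : T) (M%:Z ^+ 2))).
    by apply: ler_sum => t _; rewrite /X; case: (p t); nia.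
  by rewrite sumr_const -/M -mulr_natr -!natz natrX -exprSr.
have M0 : (0 < M)%N.
  have [v _] := card_gt0P B0; apply/card_gt0P.
  by exists (v (Ordinal (leq_trans (ltn0Sn 511) m512))).
have := second_moment X0; set S := \sum_v _ => ES.
have S1 : S <= (m * M ^ (m + 2))%:Z.
  rewrite ES -/M.
  apply: (@le_trans _ _ ((m * M ^ m.-1)%:R * (M ^ 3)%:Z)).
    by apply: ler_wpM2l.
  by rewrite natz -PoszM -mulnA -expnD; have -> : (m.-1 + 3 = m + 2)%N by lia.
have S2 : #|B|%:Z * (m ^ 2 * M ^ 2)%:Z <= 256 * S.
  rewrite /S (bigID [in B]) /= mulrDr.
  apply: ler_wpDr; first by rewrite mulr_ge0 // sumr_ge0 // => v _; rewrite sqr_ge0.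
  have -> : #|B|%:Z * (m ^ 2 * M ^ 2)%:Z = \sum_(v in B) (m ^ 2 * M ^ 2)%:Z.
    by rewrite sumr_const -mulr_natl natz.
  rewrite mulr_sumr; apply: ler_sum => v; rewrite inE -/M -/a => vB.
  rewrite /X sumrB -mulr_sumr (sp _ (fun j => p (v j))) sumr_const card_ord.
  set c := #|_| in vB *.
  have le : (m * M)%:Z <= 16 * (a%:Z *+ m - M%:Z * c%:Z).
    by rewrite -mulr_natr natz; lia.
  have -> : 256 * (M%:Z * c%:Z - a%:Z *+ m) ^+ 2 =
      (16 * (a%:Z *+ m - M%:Z * c%:Z)) ^+ 2.
    by rewrite -mulr_natr; ring.
  by rewrite -expnMn -natz natrX natz lerXn2r // ?nnegrE //; apply: le_trans le.
have : (#|B| * (m ^ 2 * M ^ 2) <= 256 * (m * M ^ (m + 2)))%N by lia.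
rewrite expnD -!mulnn => H.
have {}H : (#|B| * m <= 256 * M ^ m)%N.
  rewrite -(@leq_pmul2r (m * (M * M))); last by rewrite !muln_gt0 M0; lia.
  by move: H; set q := (M ^ m)%N; nia.
by move: H; set q := (M ^ m)%N; nia.
Qed.

End Chebyshev.

(** * VC-dimension of indexed families and of their duals *)

Section BinaryFamilies.
Local Open Scope nat_scope.

(** Indexing by a type makes the dual family a mere swap of arguments. *)
Definition fam_shatters (I : Type) (T : finType) (f : I -> T -> bool)
    (S : {set T}) : Prop :=
  forall Z : {set T}, Z \subset S -> exists i, {in S, forall x, f i x = (x \in Z)}.

Definition vc_le (I : Type) (T : finType) (f : I -> T -> bool) (d : nat) : Prop :=
  forall S, fam_shatters f S -> #|S| <= d.

Lemma vc_le_pullback (I : Type) (T T' : finType) (f : I -> T -> bool) d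
    (h : T' -> T) :
  vc_le f d -> vc_le (fun i t => f i (h t)) d.
Proof.
move=> fd S sS.
have hI : {in S &, injective h}.
  move=> x y xS yS hxy; have [|i fi] := sS [set x]; first by rewrite sub1set.
  have := fi y yS; rewrite -hxy (fi x xS) !inE eqxx => /esym/eqP //.
rewrite -(card_in_imset hI); apply: fd => Z ZS.
have [|i fi] := sS (S :&: h @^-1: Z); first exact: subsetIl.
by exists i => _ /imsetP[s sS' ->]; rewrite fi // !inE sS'.
Qed.

Lemma vc_le_xor (I : Type) (T : finType) (f : I -> T -> bool) d (y : T -> bool) :
  vc_le f d -> vc_le (fun i t => f i t (+) y t) d.
Proof.
move=> fd S sS; apply: fd => Z ZS.
have [|i fi] := sS [set x in S | (x \in Z) (+) y x].
  by apply/subsetP=> x; rewrite inE => /andP[].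
exists i => x xS; have := fi x xS; rewrite !inE xS /=.
by case: (f i x) (x \in Z) (y x) => [] [] [].
Qed.

(** In a larger shattered set of indices, label some by the subsets of ['I_d.+1]; points [x j]
    selecting exactly the labels that contain [j] are then [d + 1] points shattered by [f]. *)
Lemma vc_le_dual (I T : finType) (f : I -> T -> bool) d :
  vc_le f d -> vc_le (fun x i => f i x) (2 ^ d.+1).
Proof.
move=> fd S sS; rewrite leqNgt; apply/negP=> ltS.
have cP : #|{set 'I_d.+1}| <= #|S|.
  by rewrite -[#|{set _}|]cardsT -powersetT card_powerset cardsT card_ord ltnW.
pose e (A : {set 'I_d.+1}) : I := enum_val (widen_ord cP (enum_rank A)).
have eS A : e A \in S by apply: enum_valP.
have eI : injective e.
  by move=> A B /enum_val_inj /(congr1 val)/= /ord_inj /enum_rank_inj.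
have [x xP] : exists x : 'I_d.+1 -> T, forall j A, f (e A) (x j) = (j \in A).
  apply: (fin_all_exists (P := fun j x => forall A, f (e A) x = (j \in A))) => j.
  have [|x xP] := sS [set e A | A : {set 'I_d.+1} & j \in A].
    by apply/subsetP=> _ /imsetP[A _ ->].
  exists x => A; rewrite xP // mem_imset // inE //.
have xI : injective x.
  move=> j k jk; have := xP k [set j]; rewrite -jk xP !inE eqxx.
  by move/esym/eqP.
suff /fd : fam_shatters f [set x j | j : 'I_d.+1].
  by rewrite card_imset // card_ord ltnn.
move=> Z _; exists (e [set j | x j \in Z]) => _ /imsetP[j _ ->].
by rewrite xP inE.
Qed.

End BinaryFamilies.

(** * Double sampling and uniform approximation *)

Lemma trace_count (R : realFieldType) (I J T : finType) (f : I -> T -> bool) 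
    (d L : nat) (w : J -> T) :
  (0 < L)%N -> vc_le f d ->
  #|[set [set z | f i (w z)] | i : I]|%:R <=
    L%:R ^+ d * (1 + L%:R^-1) ^+ #|J| :> R.
Proof.
move=> L0 fd; set F := [set _ | i : I].
have : (#|F| * L ^ #|[set: J]| <= L ^ d * L.+1 ^ #|[set: J]|)%N.
  apply: sauer => // S sS.
  apply: (vc_le_pullback (h := w) fd) => Z ZS.
  have [_ /imsetP[i _ ->] BS] := sS Z ZS.
  by exists i => x xS; rewrite -BS !inE xS andbT.
have L0' : 0 < L%:R :> R by rewrite ltr0n.
rewrite cardsT -(ler_nat R) !natrM !natrX => H.
rewrite -(@ler_pM2r _ (L%:R ^+ #|J|)) ?exprn_gt0 //.
apply: le_trans H _; rewrite -mulrA -exprMn mulrDl mul1r mulVf ?gt_eqF //.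
by rewrite -natr1.
Qed.

(* Chernoff's method at the parameter 17/16, for which
   (17/16 + 16/17) / 2 = 545/544. *)
Lemma swap_tail (R : realFieldType) (n : nat) (S : {set 'I_(16 * n) * bool}) :
  (#|[set s : {ffun 'I_(16 * n) -> bool} |
      #|[set j | (j, s j) \in S]| + n < #|[set j | (j, ~~ s j) \in S]|]|)%N%:R
  <= 2 ^+ (16 * n) * (16 / 17 * (545 / 544) ^+ 16) ^+ n :> R.
Proof.
set B := finset _.
have [lam [mu [lam1 mu0 lammu sumlm muE]]] : exists lam mu : R,
    [/\ 1 <= lam, 0 <= mu, mu * lam = 1, lam + mu = 2 * (545 / 544) & mu = 16 / 17].
  by exists (17 / 16), (16 / 17); split; lra.
have lam0 : 0 <= lam by lra.
(* As [mu] is the inverse of [lam], the product of the [g j (s j)] is [lam] to the gap between the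
   two counts, which exceeds [n] on [B]. *)
pose g j b : R := mu ^+ ((j, b) \in S) * lam ^+ ((j, ~~ b) \in S).
have g0 j b : 0 <= g j b by rewrite /g mulr_ge0 ?exprn_ge0.
have gE (s : {ffun 'I_(16 * n) -> bool}) :
    \prod_j g j (s j) = mu ^+ #|[set j | (j, s j) \in S]| *
                        lam ^+ #|[set j | (j, ~~ s j) \in S]|.
  by rewrite big_split /= -!expr_sum; congr (_ ^+ _ * _ ^+ _);
     rewrite -sum1_card [RHS]big_mkcond; apply: eq_bigr => j _; rewrite inE;
     case: (_ \in S).
have -> : 2 ^+ (16 * n) * (16 / 17 * (545 / 544) ^+ 16) ^+ n =
    mu ^+ n * \prod_(j < 16 * n) (lam + mu).
  rewrite prodr_const card_ord [(16 / 17 * _) ^+ n]exprMn -exprM mulrCA -exprMn.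
  by rewrite sumlm muE.
apply: (@le_trans _ _ (mu ^+ n *
  \sum_(s : {ffun 'I_(16 * n) -> bool}) \prod_j g j (s j))).
  rewrite mulr_sumr (bigID [in B]) /=; apply: ler_wpDr.
    by apply: sumr_ge0 => s _; rewrite mulr_ge0 ?exprn_ge0 ?prodr_ge0.
  rewrite -sumr_const; apply: ler_sum => s; rewrite inE gE.
  set a := #|_|; set b := #|_|; move/ltnW/subnK <-.
  rewrite !exprD mulrA mulrA [X in _ <= X](_ : _ = lam ^+ (b - (a + n))).
    by rewrite exprn_ege1.
  rewrite [in RHS](_ : lam ^+ _ =
    lam ^+ (b - (a + n)) * (mu * lam) ^+ n * (mu * lam) ^+ a); last first.
    by rewrite lammu !expr1n !mulr1.
  rewrite !exprMn; move: (mu ^+ n) (mu ^+ a) (lam ^+ n) (lam ^+ a) (lam ^+ _).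
  by move=> *; ring.
rewrite ler_wpM2l ?exprn_ge0 // -(bigA_distr_bigA g); apply: ler_prod => j _.
rewrite sumr_ge0 => [|b _]; last exact: g0.
(* If both or neither of the points lie in [S] the sum is 2, at most [lam + mu] since
   [mu * lam = 1]; otherwise it is [lam + mu]. *)
rewrite big_bool /= /g; case: (_ \in S); case: (_ \in S);
  by rewrite ?(expr1, expr0); nra.
Qed.

(** Swapping the halves coordinatewise permutes the double samples, so it suffices to average over
    swaps for a fixed [w]. There [f] has few traces, and [swap_tail] bounds each; the power 32
    arises because a double sample has [32 * n] entries. *)
Lemma double_sample_tail (R : realFieldType) (I T : finType)
    (f : I -> T -> bool) (d e L : nat) (n := (e * d)%N) :
  (0 < L)%N -> vc_le f d ->
  #|[set w : {ffun 'I_(16 * n) * bool -> T} | [exists i,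
      #|[set j | f i (w (j, false))]| + n < #|[set j | f i (w (j, true))]|]]|%N%:R
  <= #|T|%:R ^+ (2 * (16 * n)) *
     (L%:R * ((16 / 17 * (545 / 544) ^+ 16) * (1 + L%:R^-1) ^+ 32) ^+ e) ^+ d :> R.
Proof.
move=> L0 fd; set m := (16 * n)%N; set c := 16 / 17 * _; set G := finset _.
pose sw (s : {ffun 'I_m -> bool}) (w : {ffun 'I_m * bool -> T}) :=
  [ffun z => w (z.1, z.2 (+) s z.1)] : {ffun 'I_m * bool -> T}.
have swK s : involutive (sw s).
  by move=> w; apply/ffunP=> -[j b]; rewrite !ffunE /= addbK.
have c0 : 0 <= c by rewrite /c mulr_ge0 ?exprn_ge0 //; lra.
have key w : \sum_s (sw s w \in G)%:R <=
    2 ^+ m * ((L%:R * (c * (1 + L%:R^-1) ^+ 32) ^+ e) ^+ d) :> R.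
  pose tr i : {set 'I_m * bool} := [set z | f i (w z)].
  pose ev (S : {set 'I_m * bool}) (s : {ffun 'I_m -> bool}) :=
    (#|[set j | (j, s j) \in S]| + n < #|[set j | (j, ~~ s j) \in S]|)%N.
  have swG s : (sw s w \in G)%:R <= \sum_(S in [set tr i | i : I]) (ev S s)%:R :> R.
    rewrite inE; case: existsP => [[i iP]|_]; last by apply: sumr_ge0.
    rewrite (bigD1 (tr i)) /=; last by apply: imset_f.
    apply: ler_wpDr; first exact: sumr_ge0.
    rewrite ler_nat /ev; move: iP.
    have E b : #|[set j | f i (sw s w (j, b))]| =
        #|[set j | (j, b (+) s j) \in tr i]|.
      by apply: eq_card => j; rewrite !inE ffunE.
    by rewrite !E => ->.
  apply: (@le_trans _ _ (\sum_(S in [set tr i | i : I]) (2 ^+ m * c ^+ n))).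
    apply: (le_trans (ler_sum _ (fun s _ => swG s))); rewrite exchange_big /=.
    apply: ler_sum => S _; apply: le_trans (swap_tail R S).
    rewrite -natr_sum ler_nat -sum1_card [X in (_ <= X)%N]big_mkcond.
    by rewrite leq_sum // => s _; rewrite inE -/(ev S s); case: (ev S s).
  rewrite sumr_const -[X in X <= _]mulr_natl [X in X <= _]mulrCA.
  apply: ler_wpM2l; first by rewrite exprn_ge0.
  apply: (le_trans (ler_wpM2r _ (trace_count R w L0 fd))).
    by rewrite exprn_ge0.
  have mn : (m * 2 = 32 * n)%N by rewrite /m; lia.
  rewrite card_prod card_ord card_bool mn [(L%:R * _) ^+ d]exprMn -exprM -/n.
  by rewrite [(c * _) ^+ n]exprMn -exprM -mulrA [X in _ * X <= _]mulrC.
have E : 2 ^+ m * #|G|%:R = \sum_w \sum_s (sw s w \in G)%:R :> R.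
  rewrite exchange_big /= (eq_bigr (fun=> #|G|%:R)); last first.
    move=> s _; rewrite (reindex_inj (inv_inj (swK s))) /=.
    rewrite -natr_sum -sum1_card [in RHS]big_mkcond; congr _%:R.
    by apply: eq_bigr => w _; rewrite swK; case: (_ \in G).
  by rewrite sumr_const card_ffun card_bool card_ord -[RHS]mulr_natl natrX.
rewrite -(@ler_pM2l _ (2 ^+ m)) ?exprn_gt0 // E.
apply: (le_trans (ler_sum _ (fun w _ => key w))).
rewrite sumr_const card_ffun card_prod card_ord card_bool -[X in X <= _]mulr_natl.
by rewrite natrX mulnC mulrCA.
Qed.

(** With [L = 2 ^ 12] the base stays at most 978/1000, so its 32nd power is at most 1/2; then
    [e = 32 * 14] leaves [2 ^ 12 / 2 ^ 14]. The bound [32 <= e] secures the 512 sample points that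
    Chebyshev asks for. *)
Lemma decay_exponent (R : realFieldType) : exists e L : nat,
  [/\ (32 <= e)%N, (0 < L)%N &
    L%:R * ((16 / 17 * (545 / 544) ^+ 16) * (1 + L%:R^-1) ^+ 32) ^+ e <= 4^-1 :> R].
Proof.
have sq (k : nat) (x y z : R) : 0 <= x -> x ^+ k <= y -> y ^+ 2 <= z ->
    x ^+ (k * 2) <= z.
  move=> x0 xy yz; apply: le_trans yz; rewrite exprM lerXn2r ?nnegrE ?exprn_ge0 //.
  by apply: le_trans xy; rewrite exprn_ge0.
have rB (A B : R) : 0 <= A -> 0 <= B -> A <= 34 / 33 -> B <= 128 / 127 ->
    0 <= 16 / 17 * A * B <= 978 / 1000.
  move=> A0 B0 A1 B1; have AB0 : 0 <= A * B by apply: mulr_ge0.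
  have : A * B <= 34 / 33 * (128 / 127) by apply: ler_pM.
  by rewrite -mulrA => AB1; apply/andP; split; lra.
(* The squaring chains below use (1 + 1/q)^2 <= 1 + 1/p for 2p + 1 <= q. *)
pose a : R := 545 / 544; pose b : R := 1 + 4096^-1.
have a16 : a ^+ 16 <= (34 / 33).
  apply: (sq 8%N _ (68 / 67)); [by rewrite /a; lra | | by lra].
  apply: (sq 4%N _ (136 / 135)); [by rewrite /a; lra | | by lra].
  apply: (sq 2%N _ (272 / 271)); [by rewrite /a; lra | | by lra].
  by rewrite /a; lra.
have b32 : b ^+ 32 <= (128 / 127).
  apply: (sq 16%N _ (256 / 255)); [by rewrite /b; lra | | by lra].
  apply: (sq 8%N _ (512 / 511)); [by rewrite /b; lra | | by lra].
  apply: (sq 4%N _ (1024 / 1023)); [by rewrite /b; lra | | by lra].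
  apply: (sq 2%N _ (2048 / 2047)); [by rewrite /b; lra | | by lra].
  by rewrite /b; lra.
have a0 : 0 <= a ^+ 16 by rewrite exprn_ge0 // /a; lra.
have b0 : 0 <= b ^+ 32 by rewrite exprn_ge0 // /b; lra.
exists (32 * 14)%N, (2 ^ 12)%N; split; [by [] | by [] |].
have -> : (2 ^ 12)%N%:R = 2 ^+ 12 :> R by rewrite natrX.
have -> : (2 ^+ 12)^-1 = 4096^-1 :> R by congr _^-1; ring.
rewrite -/a -/b; set r := 16 / 17 * _ * _.
have /andP[r0 r1] : 0 <= r <= 978 / 1000 by apply: rB.
have r32 : r ^+ 32 <= 2^-1.
  apply: (sq 16%N _ (706 / 1000)); [by [] | | by lra].
  apply: (sq 8%N _ (840 / 1000)); [by [] | | by lra].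
  apply: (sq 4%N _ (916 / 1000)); [by [] | | by lra].
  apply: (sq 2%N _ (957 / 1000)); [by [] | | by lra].
  by apply: (sq 1%N _ (978 / 1000)); [by [] | by rewrite expr1 | by lra].
apply: (@le_trans _ _ (2 ^+ 12 * 2^-1 ^+ 14)).
  apply: ler_wpM2l; first by rewrite exprn_ge0.
  by rewrite exprM lerXn2r ?nnegrE ?exprn_ge0 //; lra.
lra.
Qed.

(** The slack 1/8 is split evenly between the error of an independent second sample and the gap
    between the two samples. That gap has probability at most 1/4, below the 1/2 that would be
    forced if every [u] failed. *)
Lemma approximation (R : realFieldType) : exists2 K, (0 < K)%N &
  forall (I T : finType) (f : I -> T -> bool) (d : nat),
    (0 < d)%N -> (0 < #|T|)%N -> vc_le f d ->
    exists u : 'I_(K * d) -> T, forall i,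
      (8 * (K * d) * #|[set t | f i t]| <=
       8 * #|T| * #|[set j | f i (u j)]| + K * d * #|T|)%N.
Proof.
have [e [L [e32 L0 eL]]] := decay_exponent R.
exists (16 * e)%N => [|I T f d d0 T0 fd]; first by lia.
rewrite -mulnA; set n := (e * d)%N; set m := (16 * n)%N; set M := #|T|.
have m512 : (512 <= m)%N by rewrite /m /n; nia.
pose good (i : I) (v : {ffun 'I_m -> T}) :=
  (8 * m * #|[set t | f i t]| <= 8 * M * #|[set j | f i (v j)]| + m * M)%N.
have [/existsP[u /forallP ug]|] := boolP [exists u, [forall i, good i u]].
  by exists u.
rewrite negb_exists => /forallP bad; exfalso.
(* Were every sample u bad for some ii u, then by Chebyshev at least half of the
   pairs (u, v) would have a second half v accurate for ii u, hence a gap between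
   the two halves that double_sample_tail makes rare. *)
have [ii iP] : exists ii : {ffun 'I_m -> T} -> I, forall u, ~~ good (ii u) u.
  apply: (fin_all_exists (P := fun u i => ~~ good i u)) => u.
  by have := bad u; rewrite negb_forall => /existsP.
pose near i (v : {ffun 'I_m -> T}) :=
  ~~ (16 * M * #|[set j | f i (v j)]| + m * M < 16 * m * #|[set t | f i t]|)%N.
have near2 i : (M ^ m <= 2 * #|[set v | near i v]|)%N.
  have := chebyshev_sample (f i) m512; rewrite -/M.
  have := cardsC [set v | near i v]; rewrite card_ffun card_ord -/M.
  have -> : ~: [set v | near i v] = [set v : {ffun 'I_m -> T} |
     16 * M * #|[set j | f i (v j)]| + m * M < 16 * m * #|[set t | f i t]|]%N.
    by apply/setP=> v; rewrite !inE negbK.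
  lia.
pose P := [set p : {ffun 'I_m -> T} * {ffun 'I_m -> T} | near (ii p.1) p.2].
have cP : (M ^ m * M ^ m <= 2 * #|P|)%N.
  have -> : #|P| = (\sum_u #|[set v | near (ii u) v]|)%N.
    rewrite -sum1_card (eq_bigr (fun u => \sum_(v | near (ii u) v) 1))%N.
      by rewrite pair_big_dep /=; apply: eq_bigl => p; rewrite inE.
    by move=> u _; rewrite -sum1_card; apply: eq_bigl => v; rewrite inE.
  rewrite big_distrr /=; apply: (@leq_trans (\sum_(u : {ffun 'I_m -> T}) M ^ m)%N).
    by rewrite sum_nat_const card_ffun card_ord.
  by apply: leq_sum => u _; apply: near2.
pose jn (p : {ffun 'I_m -> T} * {ffun 'I_m -> T}) : {ffun 'I_m * bool -> T} :=
  [ffun z => if z.2 then p.2 z.1 else p.1 z.1].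
have jnI : injective jn.
  move=> [u v] [u' v'] /ffunP E; congr (_, _); apply/ffunP=> j.
    by have := E (j, false); rewrite !ffunE.
  by have := E (j, true); rewrite !ffunE.
have := double_sample_tail R e L0 fd; rewrite -/n -/m; set G := finset _ => HG.
have PG : (#|P| <= #|G|)%N.
  rewrite -(card_imset _ jnI); apply/subset_leq_card/subsetP.
  move=> _ /imsetP[[u v] uv ->]; move: uv (iP u).
  rewrite !inE /near /good /= => nv gu.
  apply/existsP; exists (ii u).
  have -> : #|[set j | f (ii u) (jn (u, v) (j, false))]| =
      #|[set j | f (ii u) (u j)]|.
    by apply: eq_card => j; rewrite !inE ffunE.
  have -> : #|[set j | f (ii u) (jn (u, v) (j, true))]| =
      #|[set j | f (ii u) (v j)]|.
    by apply: eq_card => j; rewrite !inE ffunE.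
  (* [u] falls short by more than 1/8 and [v] by at most 1/16, so their counts differ by more than
     [m / 16 = n]. *)
  move: nv gu; rewrite -leqNgt -ltnNge; move: #|_| #|_| #|_| => a b c nv gu.
  rewrite -(ltn_pmul2l (m := 16 * M)); last by rewrite muln_gt0.
  have mE : m = (16 * n)%N by [].
  move: nv gu; rewrite mE; lia.
have {HG} : #|G|%:R <= M%:R ^+ (2 * m) * 4^-1 :> R.
  apply: (le_trans HG); apply: ler_wpM2l; first by rewrite exprn_ge0.
  set x := (L%:R * _) in eL *; have x0 : 0 <= x.
    by rewrite mulr_ge0 // exprn_ge0 // !mulr_ge0 //
         ?exprn_ge0 ?addr_ge0 ?invr_ge0 //; lra.
  case: (d) d0 => // d' _; rewrite exprS -[X in _ <= X]mulr1.
  by rewrite ler_pM ?exprn_ge0 // exprn_ile1 //; apply: le_trans eL _; lra.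
rewrite ler_pdivlMr // -natrX -natrM ler_nat mul2n -addnn expnD.
have : (0 < M ^ m * M ^ m)%N by rewrite muln_gt0 expn_gt0 T0.
by move: cP PG; move: (M ^ m * M ^ m)%N => q; lia.
Qed.

(** * Boosting by multiplicative weights *)

Section Compression.
Local Open Scope nat_scope.

(* Multiplicative weights: the weight of x is doubled whenever the current
   hypothesis errs on x, so the total weight grows by at most 9/8 per round. *)
Lemma boosting_rounds (X : finType) (H : Type) (err : H -> X -> bool) :
  0 < #|X| ->
  (forall w : X -> nat, 0 < \sum_x w x ->
     exists h, 8 * \sum_(x | err h x) w x <= \sum_x w x) ->
  forall N, exists2 s : seq H, size s = N &
    (\sum_x 2 ^ count (err^~ x) s) * 8 ^ N <= #|X| * 9 ^ N.
Proof.
move=> X0 weak; elim=> [|N [s sN IH]].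
  by exists [::] => //; rewrite !muln1 sum1_card.
have [|h hP] := weak (fun x => 2 ^ count (err^~ x) s).
  have [x _] := card_gt0P X0.
  by rewrite (bigD1 x) //= addn_gt0 expn_gt0.
exists (h :: s); first by rewrite /= sN.
have -> : \sum_x 2 ^ count (err^~ x) (h :: s) =
    \sum_x 2 ^ count (err^~ x) s + \sum_(x | err h x) 2 ^ count (err^~ x) s.
  rewrite [X in _ + X]big_mkcond -big_split /=; apply: eq_bigr => x _.
  by case: (err h x); rewrite ?addn0 // add1n expnS mul2n addnn.
rewrite !expnS; move: hP IH; move: (\sum_x _) (\sum_(x | _) _) (8 ^ N) (9 ^ N).
by move=> a b c d; nia.
Qed.

(** A point on which more than [M] of the [4 * M] rounds err would alone weigh more than [2 ^ M],
    against a total of at most [#|X| * (9/8) ^ (4 * M)]. *)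
Lemma boosting (X : finType) (H : Type) (err : H -> X -> bool) :
  0 < #|X| ->
  (forall w : X -> nat, 0 < \sum_x w x ->
     exists h, 8 * \sum_(x | err h x) w x <= \sum_x w x) ->
  exists N (hs : 'I_N -> H), 0 < N /\
    forall x, 4 * #|[set r | err (hs r) x]| <= N.
Proof.
move=> X0 weak; set M := 5 * #|X|.
have [s sN sP] := boosting_rounds X0 weak (4 * M).
exists (size s), (tnth (in_tuple s)); split=> [|x].
  by rewrite sN /M !muln_gt0.
have -> : #|[set r | err (tnth (in_tuple s) r) x]| = count (err^~ x) s.
  rewrite -sum1_count big_tnth -sum1_card.
  by apply: eq_bigl => r; rewrite inE.
rewrite sN leq_pmul2l // leqNgt; apply/negP=> Mlt.
have {sP} sP : 2 ^ M * 8 ^ (4 * M) <= #|X| * 9 ^ (4 * M).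
  apply: leq_trans sP; rewrite leq_mul2r; apply/orP; right.
  rewrite (bigD1 x) //=; apply: leq_trans (leq_addr _ _).
  by rewrite leq_exp2l // ltnW.
have lt29 : 2 ^ #|X| * 9 ^ (4 * M) <= 2 ^ M * 8 ^ (4 * M).
  (* Twenty rounds per point of [X] leave a spare factor 2 per point, and [2 ^ #|X|] exceeds
     [#|X|]. *)
  have lt1 : 2 * 9 ^ 20 <= 2 ^ 5 * 8 ^ 20 by lia.
  have -> : 4 * M = 20 * #|X| by rewrite /M mulnA.
  by rewrite /M !expnM -!expnMn leq_exp2r.
have := leq_trans lt29 sP.
by rewrite leq_pmul2r ?expn_gt0 // leqNgt ltn_expl.
Qed.

(** [f i x] stands for an error of [i] at [x], and [hyp t] for a concept consistent on the points of
    [t]. One sampling provides weak learners for boosting; a second one thins the boosted list. *)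
Lemma boosted_majority (R : realFieldType) : exists2 K, 0 < K &
  forall (X I : finType) (f : I -> X -> bool) (d : nat)
    (hyp : {ffun 'I_(K * d) -> X} -> I),
    0 < #|X| -> 0 < d -> vc_le f d ->
    (forall t j, f (hyp t) (t j) = false) ->
    exists t : 'I_(K * 2 ^ d.+1) -> {ffun 'I_(K * d) -> X},
    forall x, K * 2 ^ d.+1 < 2 * #|[set r | ~~ f (hyp (t r)) x]|.
Proof.
have [K K0 approx] := approximation R; exists K => // X I f d hyp X0 d0 fd cons.
have [||N [hs [N0 hsP]]] := @boosting X _ (fun t => f (hyp t)) => //.
  (* Taking [w x] copies of each [x] turns weights into uniform counting. *)
  move=> w w0; pose T : finType := {x : X & 'I_(w x)}.
  have cT : #|T| = \sum_x w x.
    rewrite card_tagged sumnE big_map big_enum /=.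
    by apply: eq_bigr => x _; rewrite card_ord.
  have [||u uP] := approx I T (fun i p => f i (tag p)) d d0.
  - by rewrite cT.
  - exact: vc_le_pullback.
  exists [ffun j => tag (u j)]; have := uP (hyp [ffun j => tag (u j)]).
  set c := hyp _; have -> : [set j | f c (tag (u j))] = set0.
    apply/setP=> j; rewrite !inE.
    by have := cons [ffun j => tag (u j)] j; rewrite ffunE.
  rewrite cards0 muln0 add0n cT.
  have -> : #|[set p : T | f c (tag p)]| = \sum_(x | f c x) w x.
    rewrite -sum1_card (eq_bigr (fun x => \sum_(i : 'I_(w x)) 1)).
      rewrite sig_big_dep /=; apply: eq_bigl => p; rewrite inE andbT //.
    by move=> x _; rewrite sum1_card card_ord.
  by rewrite -mulnA mulnCA leq_pmul2l // muln_gt0 K0.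
have [|||u uP] := approx X 'I_N (fun x r => ~~ f (hyp (hs r)) x) (2 ^ d.+1).
- by rewrite expn_gt0.
- by rewrite card_ord.
- apply: (vc_le_pullback (h := fun r => hyp (hs r)) (f := fun x i => ~~ f i x)).
  apply: (vc_le_dual (f := fun i x => ~~ f i x)) => S sS.
  apply: (vc_le_xor (y := xpredT) fd) => Z ZS; have [i iP] := sS Z ZS.
  by exists i => x /iP; rewrite addbT.
exists (hs \o u) => x; have := uP x; have := hsP x; rewrite card_ord /=.
have := cardsC [set r | f (hyp (hs r)) x]; rewrite card_ord.
have -> : ~: [set r | f (hyp (hs r)) x] = [set r | ~~ f (hyp (hs r)) x].
  by apply/setP=> r; rewrite !inE.
(* A correct share of at least 3/4 in the list leaves at least 3/4 - 1/8 = 5/8 among the sampled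
   rounds, a strict majority. *)
have lin (m a b c : nat) : 0 < m -> a + b = N -> 4 * a <= N ->
    8 * m * b <= 8 * N * c + m * N -> m < 2 * c.
  move=> m0 abN a4 H; have h1 := leq_mul (leqnn (2 * m)) a4.
  have h2 : m * (a + b) = m * N by rewrite abN.
  have : N * (5 * m) <= N * (8 * c) by lia.
  by rewrite leq_pmul2l //; lia.
by apply: lin; rewrite muln_gt0 K0 expn_gt0.
Qed.

(** * Size and VC-dimension of a concept class *)

Lemma vc_le_vc_dim (X : finType) (C : concept_class X) :
  vc_le (fun (c : {c | c \in C}) x => val c x) (vc_dim C).
Proof.
move=> S sS; rewrite /vc_dim (leq_bigmax_cond (F := fun Y : {set X} => #|Y|)) //.
apply/forallP=> Z; apply/implyP=> ZS; have [c cP] := sS Z ZS.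
apply/existsP; exists (val c); rewrite (valP c) /=; apply/andP; split.
  by apply/forallP=> x; apply/implyP=> xZ; rewrite cP ?xZ // (subsetP ZS).
apply/forallP=> x; apply/implyP; rewrite inE => /andP[xZ xS].
by rewrite cP // (negbTE xZ).
Qed.

(** All subsets of a largest shattered set are traces of concepts. It yields [4 <= #|C|] in
    dimension at least 2. *)
Lemma exp_vc_dim (X : finType) (C : concept_class X) :
  0 < #|C| -> 2 ^ vc_dim C <= #|C|.
Proof.
move=> /card_gt0P[c0 c0C].
have s0 : shatters C set0.
  apply/forallP=> Z; apply/implyP; rewrite subset0 => /eqP ->.
  apply/existsP; exists c0; rewrite c0C /=.
  by apply/andP; split; apply/forallP=> x; rewrite !inE.
have [|Y sY vE] := @eq_bigmax_cond _ (shatters C) (fun Y => #|Y|).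
  by apply/card_gt0P; exists set0.
have -> : vc_dim C = #|Y| by [].
rewrite -card_powerset.
have := leq_imset_card (fun c : {ffun X -> bool} => [set x in Y | c x]) (mem C).
apply: leq_trans.
apply/subset_leq_card/subsetP=> Z; rewrite inE => ZY.
have /forallP/(_ Z)/implyP/(_ ZY)/existsP[c] := sY.
case/and3P=> cC /forallP c1 /forallP c2.
apply/imsetP; exists c => //; apply/setP=> x; rewrite inE.
have := c1 x; have := c2 x; have := subsetP ZY x; rewrite inE.
case: (x \in Z) => /= [-> // _ /eqP -> //|_].
by case: (x \in Y) => //= /eqP ->.
Qed.

Lemma vc_dim_gt0 (X : finType) (C : concept_class X) : 1 < #|C| -> 0 < vc_dim C.
Proof.
move=> /card_gt1P[c [c' [cC c'C cc']]].
have [x xP] : exists x, c x != c' x.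
  apply/existsP; rewrite -negb_forall; apply: contra cc' => /forallP cE.
  by apply/eqP/ffunP=> x; apply/eqP.
rewrite -(cards1 x) /vc_dim (leq_bigmax_cond (F := fun Y : {set X} => #|Y|)) //.
apply/forallP=> Z; apply/implyP=> Zx; apply/existsP.
have [c1 c1C c1x] : exists2 c1, c1 \in C & c1 x = (x \in Z).
  case: (boolP (c x == (x \in Z))) => [/eqP|] H; first by exists c.
  by exists c' => //; move: H xP; case: (c x) (c' x) (x \in Z) => [] [] [].
exists c1; rewrite c1C /=; apply/andP; split; apply/forallP=> y; apply/implyP.
  move=> yZ; have := subsetP Zx y yZ; rewrite inE => /eqP yx.
  by rewrite yx c1x -yx yZ.
by rewrite !inE => /andP[yZ /eqP yx]; rewrite yx c1x -yx (negbTE yZ).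
Qed.

(** * Encoding and decoding a sample *)

Section Scheme.
Variables (X : finType) (C : concept_class X) (m n : nat).
Let k := m * n.
Let Q := {ffun 'I_m * 'I_n -> 'I_k}.

(* q (r, j) is the position in enum Z of the j-th point of the r-th subsample. *)
Definition decode (z : sample X) (q : Q) (r : 'I_m) : {ffun X -> bool} :=
  odflt [ffun=> false] [pick c in C | [forall j, forall v : {x | x \in tag z},
    (index (val v) (enum (tag z)) == q (r, j)) ==> (c (val v) == tagged z v)]].

Definition majority (h : 'I_m -> {ffun X -> bool}) : {ffun X -> bool} :=
  [ffun x => m < 2 * #|[set r | h r x]|].

Lemma majorityE (h : 'I_m -> {ffun X -> bool}) (b : bool) x :
  m < 2 * #|[set r | h r x == b]| -> majority h x = b.
Proof.
rewrite ffunE; case: b => H.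
  by rewrite -[RHS]H; congr (_ < 2 * _); apply: eq_card => r; rewrite !inE eqb_id.
have := cardsC [set r | h r x]; rewrite card_ord.
have -> : ~: [set r | h r x] = [set r | h r x == false].
  by apply/setP=> r; rewrite !inE eqbF_neg.
by move: H; lia.
Qed.

(** The reconstruction repeats the choices of the learner: the stored positions recover each
    labelled subsample, and [pick] depends only on its predicate, so [decode] returns the very
    concept that was voted on. *)
Lemma scheme_of_subsamples :
  (forall (Y : {set X}) (c : {ffun X -> bool}), 0 < #|Y| -> c \in C ->
     exists t : 'I_m -> {ffun 'I_n -> {x | x \in Y}},
     forall x : {x | x \in Y}, m < 2 * #|[set r |
       odflt [ffun=> false] [pick c' in C |
         [forall j, c' (val (t r j)) == c (val (t r j))]] (val x) == c (val x)]|) ->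
  has_compression_scheme C k Q.
Proof.
move=> Ht.
pose rho (zq : L C 0 k * Q) := majority (decode (sval zq.1) zq.2).
suff /choice[kappa kP] : forall s : L C 1 #|X|, exists zq : L C 0 k * Q,
    subsample (sval zq.1) (sval s) /\
    restr (tag (sval s)) (rho zq) = tagged (sval s).
  by exists kappa, rho.
move=> [[Y y] sP]; have := sP.
rewrite /labelled_sample /= => /andP[/andP[Y0 _] /imsetP[c cC yE]].
have [t tP] := Ht Y c Y0 cC.
pose Z := [set val (t p.1 p.2) | p : 'I_m * 'I_n].
have Zk : #|Z| <= k.
  by apply: leq_trans (leq_imset_card _ _) _; rewrite card_prod !card_ord.
have tZ r j : val (t r j) \in Z by apply/imsetP; exists (r, j).
have iZ p : index (val (t p.1 p.2)) (enum Z) < k.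
  by apply: leq_trans Zk; rewrite cardE index_mem mem_enum.
pose q : Q := [ffun p => Ordinal (iZ p)].
pose z : sample X := Tagged _ (restr Z c).
have zP : labelled_sample C 0 k z.
  by rewrite /labelled_sample /= Zk; apply: imset_f.
have ZY x : x \in Z -> x \in Y by case/imsetP=> p _ ->; apply: valP.
exists (exist _ z zP, q); split=> /=.
  split=> [|u v uv] /=; first by apply/subsetP.
  by rewrite yE !ffunE uv.
rewrite yE; apply/ffunP=> x; rewrite [LHS]ffunE [RHS]ffunE /rho /=.
apply: majorityE; apply: leq_trans (tP x) _.
rewrite leq_pmul2l //; apply/subset_leq_card/subsetP=> r; rewrite !inE.
suff -> : decode z q r = odflt [ffun=> false] [pick c' in C |
    [forall j, c' (val (t r j)) == c (val (t r j))]] by [].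
congr odflt; apply: eq_pick => c' /=.
congr (_ && _); apply/forallP/forallP=> H j; last first.
  apply/forallP=> v; apply/implyP=> /eqP; rewrite !ffunE /= => E.
  suff -> : val v = val (t r j) by apply: H.
  have vZ : val v \in enum Z by rewrite mem_enum (valP v).
  by have := nth_index (val v) vZ; rewrite E nth_index ?mem_enum ?tZ.
pose v : {x | x \in tag z} := exist (fun x => x \in Z) (val (t r j)) (tZ r j).
have /forallP/(_ v)/implyP := H j.
by rewrite !ffunE /= => ->.
Qed.

End Scheme.

Lemma compression_scheme_vc (R : realFieldType) : exists2 K, 0 < K &
  forall (X : finType) (C : concept_class X), 1 < #|C| ->
  let m := K * 2 ^ (vc_dim C).+1 in let n := K * vc_dim C in
  has_compression_scheme C (m * n) {ffun 'I_m * 'I_n -> 'I_(m * n)}.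
Proof.
have [K K0 HK] := boosted_majority R; exists K => // X C C2 m n.
apply: scheme_of_subsamples => Y c Y0 cC.
pose I : finType := {c | c \in C}.
pose XY : finType := {x | x \in Y}.
pose f (i : I) (x : XY) := val i (val x) (+) c (val x).
pose learn (t : {ffun 'I_n -> XY}) := odflt [ffun=> false]
  [pick c' in C | [forall j, c' (val (t j)) == c (val (t j))]].
(* [c] itself passes the test, so the default is never returned. *)
have learnP t : (learn t \in C) && [forall j, learn t (val (t j)) == c (val (t j))].
  rewrite /learn; case: pickP => [c' //|/(_ c)].
  by rewrite cC /= => /negP[]; apply/forallP=> j.
have learnC t : learn t \in C by case/andP: (learnP t).
pose hyp t : I := exist _ (learn t) (learnC t).
have [||||t tP] := HK XY I f (vc_dim C) hyp.
- by rewrite card_sig.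
- exact: vc_dim_gt0.
- apply: (vc_le_xor (y := fun x => c (val x))).
  exact: (vc_le_pullback (h := fun x : XY => val x) (@vc_le_vc_dim X C)).
- move=> t j; have /andP[_ /forallP/(_ j)/eqP E] := learnP t.
  by rewrite /f /= E addbb.
exists t => x; have := tP x; congr (_ < 2 * _); apply: eq_card => r.
by rewrite !inE /f /= /learn negb_add.
Qed.

End Compression.

(** * Numerical bounds on [k] and [Q] *)

Theorem theorem1p6 (R : realType) :
  exists alpha beta : R, 0 < alpha /\ 0 < beta /\
    forall (X : finType) (C : concept_class X) (d : nat),
      (2 <= #|C|)%N -> vc_dim C = d ->
      exists (k : nat) (Q : finType),
        [/\ (0 < k)%N, (0 < #|Q|)%N,
            k%:R <= alpha * (d%:R * 2 ^+ d * log2 (log2 #|C|%:R)) + beta,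
            log2 #|Q|%:R <= alpha * (k%:R * log2 k%:R) + beta &
            has_compression_scheme C k Q].
Proof.
have [K K0 HK] := compression_scheme_vc R.
have K1 : 1 <= K%:R ^+ 2 :> R by rewrite exprn_ege1 // ler1n.
(* [k] will be [2 * K ^ 2 * d * 2 ^ d]; [beta] is its value at [d = 1], where [log log #|C|] may
   vanish. *)
exists (2 * K%:R ^+ 2), (4 * K%:R ^+ 2); split; first by lra.
split=> [|X C d C2 dE]; first by lra.
have ln2 : 0 < ln 2 :> R by rewrite ln_gt0 // ltr1n.
have d0 : (0 < d)%N by rewrite -dE vc_dim_gt0.
have := HK X C C2; cbv zeta; rewrite dE; set k := (K * 2 ^ d.+1 * (K * d))%N => HQ.
have k0 : (0 < k)%N by rewrite !muln_gt0 K0 expn_gt0 d0.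
have cQ : #|{: {ffun 'I_(K * 2 ^ d.+1) * 'I_(K * d) -> 'I_k}}| = (k ^ k)%N.
  by rewrite card_ffun card_prod !card_ord.
exists k, {ffun 'I_(K * 2 ^ d.+1) * 'I_(K * d) -> 'I_k}.
have log2_le (x y : R) : 0 < x -> x <= y -> log2 x <= log2 y.
  move=> x0 xy; rewrite /log2 ler_pM2r ?invr_gt0 // ler_ln // posrE //.
  exact: lt_le_trans xy.
have log21 : log2 1 = 0 :> R by rewrite /log2 ln1 mul0r.
have log22 : log2 2 = 1 :> R by rewrite /log2 divff // gt_eqF.
have log24 : log2 4 = 2 :> R.
  rewrite /log2 (_ : 4 = 2 ^+ 2); last by rewrite -natrX.
  by rewrite lnXn // mulrnAl divff ?gt_eqF.
split=> //.
- by rewrite cQ expn_gt0 k0.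
- have -> : k%:R = 2 * K%:R ^+ 2 * (d%:R * 2 ^+ d) :> R.
    by rewrite /k !natrM natrX exprS; ring.
  have dd0 : 0 <= d%:R * 2 ^+ d :> R by rewrite mulr_ge0 // exprn_ge0.
  have l1 : 1 <= log2 #|C|%:R :> R.
    by rewrite -[X in X <= _]log22 log2_le // ler_nat.
  have ll0 : 0 <= log2 (log2 #|C|%:R) :> R by rewrite -[X in X <= _]log21 log2_le.
  case: (ltngtP d 1) => [|d1|d1]; first by rewrite ltnNge d0.
    suff ll1 : 1 <= log2 (log2 #|C|%:R) :> R.
      apply: ler_wpDr; first by lra.
      rewrite ler_wpM2l //; first by lra.
      by rewrite -[X in X <= _]mulr1 ler_wpM2l.
    rewrite -[X in X <= _]log22 log2_le // -[X in X <= _]log24 log2_le // ler_nat.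
    apply: leq_trans (exp_vc_dim (ltnW C2)); rewrite dE.
    by rewrite (_ : 4 = 2 ^ 2)%N // leq_exp2l.
  apply: ler_wpDl; last by rewrite d1; lra.
  by rewrite mulr_ge0 ?(mulr_ge0 dd0 ll0) //; lra.
- have lk : 0 <= k%:R * log2 k%:R :> R.
    by rewrite mulr_ge0 // -[X in X <= _]log21 log2_le // ler1n.
  have -> : log2 #|{: {ffun 'I_(K * 2 ^ d.+1) * 'I_(K * d) -> 'I_k}}|%:R =
      k%:R * log2 k%:R :> R.
    by rewrite cQ natrX /log2 lnXn ?ltr0n // !mulrnAl mul1r.
  by apply: ler_wpDr; [lra | rewrite ler_peMl //; lra].
Qed.
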